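(* For every $a\in[1,\infty)$ there is a constant $c=c(a)\in(0,\infty)$ such that for every integer $n\ge 20$ and every $\alpha\in[1,\infty)$ with $\frac{1}{a}\log n\le\alpha\le a\log n$ we have $$k_n^{\alpha}(\ell_\infty)\ge c\,\frac{\log n}{\log\log\log n}.$$ Here $k_n^\alpha(\ell_\infty)$ is the minimum $k\in\mathbb N$ such that every $n$-point metric space embeds with distortion $\alpha$ into some $k$-dimensional normed space (which may depend on the metric space).
   Context: Logarithms are natural. A metric space $(\mathcal M,d_{\mathcal M})$ embeds with distortion $\alpha$ into a metric space $(\mathcal N,d_{\mathcal N})$ if there are $f:\mathcal M\to\mathcal N$ and $\tau>0$ such that $\tau d_{\mathcal M}(x,y)\le d_{\mathcal N}(f(x),f(y))\le\alpha\tau d_{\mathcal M}(x,y)$ for all $x,y\in\mathcal M$. In the paper $k_n^\alpha(X)$, for a normed space $X$, is the minimum $k\in\mathbb N$ such that every $n$-point subset of $X$ embeds with distortion $\alpha$ into some $k$-dimensional linear subspace of $X$; for $X=\ell_\infty$ this is the quantity described in the statement. *)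

(* Defs.v *)
From HB Require Import structures.
From mathcomp Require Import all_boot all_order all_algebra.
From mathcomp Require Import all_classical all_reals all_analysis.

Set Implicit Arguments.
Unset Strict Implicit.
Unset Printing Implicit Defensive.

Import Order.TTheory GRing.Theory Num.Theory.
Import numFieldNormedType.Exports.

Local Open Scope classical_set_scope.
Local Open Scope ring_scope.

(* The distances are explicit arguments because a [normedModType] does not
   inherit a [metricType] structure. *)
Definition embeds_with_distortion (R : realType) (M N : Type)
    (dM : M -> M -> R) (dN : N -> N -> R) (alpha : R) : Prop :=
  exists (f : M -> N) (tau : R), 0 < tau /\
    forall x y, tau * dM x y <= dN (f x) (f y) <= alpha * tau * dM x y.

Definition norm_dist (R : realType) (V : normedModType R) (x y : V) : R :=
  `|x - y|.

Definition has_dim (R : realType) (V : normedModType R) (k : nat) : Prop :=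
  inhabited (Vector.axiom k V).

Definition admissible_dim (R : realType) (n : nat) (alpha : R) : set nat :=
  [set k | forall M : metricType R, ([set: M] #= `I_n)%card ->
    exists V : normedModType R, has_dim V k /\
      embeds_with_distortion (@mdist R M) (@norm_dist R V) alpha].

(* The quantity $k_n^\alpha(\ell_\infty)$. The default value 0 is only taken
   when no dimension is admissible, which is impossible for [1 <= alpha]
   (see [k_linfP]). *)
Definition k_linf (R : realType) (n : nat) (alpha : R) : nat :=
  xget 0%N [set k | admissible_dim n alpha k /\
                    forall j, admissible_dim n alpha j -> (k <= j)%N].

(* Fréchet embedding into the n-dimensional space with the maximum norm *)
Lemma admissible_dim_card (R : realType) (n : nat) (alpha : R) :
  1 <= alpha -> admissible_dim n alpha n.
Proof.
move=> alpha1 M Mn; exists 'rV[R]_n; split.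
  by constructor; exists id => //; exists id.
have /card_bijP[f [g fK gK]] : ([set: M] #= [set: 'I_n])%card.
  exact: card_eq_trans Mn card_II.
pose q (y : M) : 'I_n := val (f (to_setT y)).
pose p (i : 'I_n) : M := val (g (to_setT i)).
have qK y : p (q y) = y.
  rewrite /p /q; have -> : to_setT (val (f (to_setT y))) = f (to_setT y).
    exact: val_inj.
  by rewrite fK.
exists (fun x => \row_i mdist x (p i)), 1; split => // x y.
rewrite mul1r mulr1.
suff -> : norm_dist (\row_i mdist x (p i)) (\row_i mdist y (p i)) = mdist x y.
  by rewrite lexx/= ler_peMl// mdist_ge0.
rewrite /norm_dist /Num.norm/= mx_normrE; apply/eqP.
rewrite eq_le; apply/andP; split.
  apply/bigmax_leP; split; first exact: mdist_ge0.
  move=> [i j] _ /=; rewrite !mxE ler_distl; apply/andP; split.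
    rewrite lerBlDr addrC (metric_sym x y).
    by have := metric_triangle y x (p j); rewrite addrC.
  by have := metric_triangle x y (p j); rewrite addrC.
apply/bigmax_geP; right; exists (ord0, q y) => //=.
by rewrite !mxE qK mdistxx subr0 ger0_norm// mdist_ge0.
Qed.

Lemma k_linfP (R : realType) (n : nat) (alpha : R) : 1 <= alpha ->
  admissible_dim n alpha (k_linf n alpha) /\
  forall j, admissible_dim n alpha j -> (k_linf n alpha <= j)%N.
Proof.
move=> alpha1.
have ex : exists k, `[< admissible_dim n alpha k >].
  by exists n; apply/asboolP; exact: admissible_dim_card.
suff : [set k | admissible_dim n alpha k /\
    forall j, admissible_dim n alpha j -> (k <= j)%N] (k_linf n alpha) by [].
apply: xgetPex; exists (ex_minn ex); case: ex_minnP => k /asboolP kP kmin.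
by split => // j jP; apply: kmin; apply/asboolP.
Qed.

(* Main.v *)
From HB Require Import structures.
Require Import Defs.
From mathcomp Require Import all_boot all_order all_algebra.
From mathcomp Require Import all_classical all_reals all_analysis.
From mathcomp Require Import finfield.
From mathcomp Require Import ring lra zify.
Import Order.TTheory GRing.Theory Num.Theory.
Import numFieldNormedType.Exports.
Set Implicit Arguments.
Unset Strict Implicit.
Unset Printing Implicit Defensive.
Local Open Scope ring_scope.

(** The obstruction is a metric space with at most n points whose images
    concentrate in every normed space of dimension about log n; a volume
    comparison then bounds the dimension from below.

    Let K be a finite field whose cardinality q is a fixed power of log n, up
    to constants, and let X = K^(4r) with q^(4r) <= n, so that r is of order
    log n / log log n. Give X the word metric, truncated at r, of the
    generators t (1, s, ..., s^(4r-1)) with s, t in K. There are at most q^2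
    of them, so at most q^(2r) points of X lie at distance less than r from a
    given point, a small fraction of the q^(4r) points.

    Suppose that f maps X to a k-dimensional normed space and satisfies
    d(x,y) <= |f x - f y| <= alpha d(x,y). For each s, averaging over the
    lines in direction (1, s, ..., s^(4r-1)) is a projection; these projections
    commute, and by the Vandermonde determinant the product of any 4r of them
    annihilates the functions of mean zero. Hence the energies of the q line
    averages of a mean-zero function sum to at most 4r times its energy
    ([line_avg_energy]), and a typical direction reduces the energy by a factor
    of order r/q. Written in a basis with coordinates in [-1, 1]
    ([barycentric_coords]), the map f loses only powers of k and r, which q
    absorbs. So for some s the line averages of f are within alpha of the mean
    of f at half of the points, while f is within alpha of its line averages
    everywhere: half of X is mapped into a ball of radius 2 alpha
    ([concentration]).

    That half contains at least q^(2r)/2 points at mutual distance r, whose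
    images are r-separated in a ball of radius 2 alpha. Comparing volumes
    ([packing_bound]) gives q^(2r) <= 2 (16 alpha/r)^k ([dimension_bound]).
    Since alpha <= a log n, the ratio alpha/r is O(log log n), whereas the
    logarithm of the left-hand side is of order log n; taking logarithms gives
    the theorem. An equilateral space would only give the ratio alpha, hence
    log n / log log n: the gain is that X concentrates at nearly the scale at
    which it is spread out. *)

(** * Packing in a finite-dimensional normed space *)

(** The expansion in base [lam] with digits [y i]: with a small [lam], a
    separated family of [M] points yields [M ^ J] points that are still
    separated, at scale [lam ^ J]. *)
Fixpoint digit_sum (R : realType) (V : lmodType R) (I : Type) (y : I -> V)
    (lam : R) (w : seq I) : V :=
  if w is i :: w' then y i + lam *: digit_sum y lam w' else 0.

(* The norm is replaced by a seminorm so that the bound also applies to the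
   absolute values of coordinates. *)
Section DigitSums.
Variables (R : realType) (V : lmodType R) (p : V -> R).
Hypothesis pD : forall u v, p (u + v) <= p u + p v.
Hypothesis pZ : forall c v, p (c *: v) = `|c| * p v.
Variables (I : eqType) (y : I -> V) (lam : R).
Hypotheses (lam0 : 0 <= lam) (lam2 : lam <= 1 / 2).

Lemma seminormN v : p (- v) = p v.
Proof. by rewrite -scaleN1r pZ normrN1 mul1r. Qed.

Lemma seminormB u v : p (u - v) <= p u + p v.
Proof. by rewrite -[p v in leRHS]seminormN pD. Qed.

Lemma seminorm_digit_sum (rad : R) (w : seq I) : 0 <= rad ->
  (forall i, p (y i) <= rad) -> p (digit_sum y lam w) <= 2 * rad.
Proof.
move=> rad0 prad; elim: w => [|i w IH] /=.
  by rewrite -(scale0r 0) pZ normr0 mul0r mulr_ge0.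
apply: le_trans (pD _ _) _; rewrite pZ ger0_norm//.
have : lam * p (digit_sum y lam w) <= 1 / 2 * (2 * rad).
  apply: (le_trans (y := lam * (2 * rad))); first exact: ler_wpM2l.
  by apply: ler_wpM2r => //; rewrite mulr_ge0.
have := prad i; lra.
Qed.

(** At the first digit where the words differ, the separation [rho] of the
    digits dominates the tails, which [lam * (8 * rad) = rho] keeps below
    [rho / 2]. *)
Lemma digit_sum_separated (rad rho : R) (w w' : seq I) : 0 <= rad -> 0 <= rho ->
    (forall i, p (y i) <= rad) ->
    (forall i j, i != j -> rho <= p (y i - y j)) ->
    lam * (8 * rad) = rho ->
    size w = size w' -> w != w' ->
  lam ^+ size w * (rho / 2) <= p (digit_sum y lam w - digit_sum y lam w').
Proof.
move=> rad0 rho0 prad psep lamrho.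
elim: w w' => [|i w IH] [|j w'] //= [eqs] neq.
have [eij|nij] := eqVneq i j.
  rewrite eij opprD addrACA subrr add0r -scalerBr pZ ger0_norm// exprS -mulrA.
  apply: ler_wpM2l => //; apply: IH => //.
  by apply: contra neq => /eqP ->; rewrite eij.
set u := digit_sum y lam w; set v := digit_sum y lam w'.
have pu : p u <= 2 * rad by exact: seminorm_digit_sum.
have pv : p v <= 2 * rad by exact: seminorm_digit_sum.
have -> : y i + lam *: u - (y j + lam *: v) = (y i - y j) + lam *: (u - v).
  by rewrite scalerBr opprD addrACA.
have low : p (y i - y j) <= p (y i - y j + lam *: (u - v)) + lam * p (u - v).
  have := seminormB (y i - y j + lam *: (u - v)) (lam *: (u - v)).
  by rewrite addrK pZ ger0_norm.
have tail : lam * p (u - v) <= rho / 2.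
  apply: (le_trans (y := lam * (4 * rad))); last lra.
  by apply: ler_wpM2l => //; have := seminormB u v; lra.
have pow1 : lam ^+ (size w).+1 * (rho / 2) <= rho / 2.
  rewrite -[leRHS]mul1r; apply: ler_wpM2r; first by lra.
  apply: exprn_ile1 => //; apply: le_trans lam2 _; lra.
have := psep _ _ nij; lra.
Qed.

End DigitSums.

Lemma bounded_powers_le1 (R : realType) (x b : R) :
  0 <= x -> (forall J : nat, x ^+ J <= b) -> x <= 1.
Proof.
move=> x0 xb; rewrite leNgt; apply/negP => x1.
(* Bernoulli: a power of x > 1 exceeds any bound. *)
have bern (J : nat) : J%:R * (x - 1) <= x ^+ J.
  elim: J => [|J IH]; first by rewrite mul0r expr0.
  have h : 1 <= x ^+ J by apply: exprn_ege1; exact: ltW.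
  rewrite exprS -addn1 natrD mulrDl mul1r.
  have : (x - 1) * 1 <= (x - 1) * x ^+ J by apply: ler_wpM2l => //; lra.
  lra.
have b0 : 0 <= b by apply: le_trans (xb 0%N); rewrite expr0.
have x10 : 0 < x - 1 by lra.
have bx0 : 0 <= b / (x - 1) by rewrite divr_ge0// ltW.
have := truncnS_gt (b / (x - 1)).
rewrite ltr_pdivrMr// => h.
have := le_trans (bern _) (xb (Num.truncn (b / (x - 1))).+1).
by rewrite leNgt h.
Qed.

Lemma grid_cell_eq (R : realType) (h B s t : R) : 0 < h ->
    -B <= s -> - B <= t ->
    Num.truncn ((s + B) / h) = Num.truncn ((t + B) / h) ->
  `|s - t| <= h.
Proof.
move=> h0 sB tB e.
have s0 : 0 <= (s + B) / h by apply: divr_ge0; [lra|exact: ltW].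
have t0 : 0 <= (t + B) / h by apply: divr_ge0; [lra|exact: ltW].
have := truncn_itv s0; have := truncn_itv t0; rewrite -e.
set n := Num.truncn _.
rewrite !ler_pdivlMr// !ltr_pdivrMr// -natr1 mulrDl mul1r.
move=> /andP[t1 t2] /andP[s1 s2].
by rewrite ler_norml; apply/andP; split; lra.
Qed.

Lemma has_dim_coord (R : realType) (V : normedModType R) (k : nat) :
  has_dim V k -> exists v2r : {linear V -> 'rV[R]_k}, bijective v2r.
Proof.
move=> [[f fL fb]].
pose F : {linear V -> 'rV[R]_k} := HB.pack f (GRing.isLinear.Build _ _ _ _ f fL).
by exists F.
Qed.

Lemma norm_le_coord (R : realType) (V : normedModType R) (k : nat)
    (v2r : {linear V -> 'rV[R]_k}) : bijective v2r -> exists2 E : R, 0 <= E &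
  forall (u v : V) (h : R), 0 <= h ->
    (forall i, `|v2r u 0 i - v2r v 0 i| <= h) -> `|u - v| <= h * E.
Proof.
case=> r2v vK rK.
have fS (x : 'rV[R]_k) : r2v x = \sum_i x 0 i *: r2v (delta_mx 0 i).
  rewrite [in LHS](row_sum_delta x); apply: (can_inj vK); rewrite rK.
  by rewrite linear_sum; apply: eq_bigr => i _; rewrite linearZZ rK.
exists (\sum_i `|r2v (delta_mx 0 i)|); first exact: sumr_ge0.
move=> u v h h0 uv.
rewrite -(vK (u - v)) fS; apply: le_trans (ler_norm_sum _ _ _) _.
rewrite mulr_sumr; apply: ler_sum => i _.
by rewrite normrZ; apply: ler_wpM2r => //; rewrite linearB !mxE.
Qed.

(** Volumes are avoided by a tensor-power argument. Any crude bound
    [(A / eps) ^ k] on the number of [eps]-separated points in a ball, with [A]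
    depending on the space, applies to the [#|I| ^ J] digit sums, which are
    separated at scale [lam ^ J]. Taking [J]-th roots removes [A] and leaves
    [#|I| <= (1 / lam) ^ k]. The crude bound is the pigeonhole principle on a
    grid in coordinates. *)
Lemma packing_centered (R : realType) (V : normedModType R) (k : nat)
    (v2r : {linear V -> 'rV[R]_k}) (I : finType) (y : I -> V) (rad rho : R) :
    bijective v2r -> 0 < rho -> (1 < #|I|)%N ->
    (forall i, `|y i| <= rad) ->
    (forall i j, i != j -> rho <= `|y i - y j|) ->
  #|I|%:R <= (8 * rad / rho) ^+ k.
Proof.
move=> v2rb rho0 card_gt1 yrad ysep.
have rad_rho : rho <= 2 * rad.
  have /card_gt1P[i [j [_ _ ij]]] := card_gt1.
  apply: le_trans (ysep _ _ ij) _; apply: le_trans (ler_normB _ _) _.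
  by rewrite mulr_natl mulr2n lerD.
have rad0 : 0 < rad by clear -rho0 rad_rho; lra.
pose lam := rho / (8 * rad).
have lam0 : 0 < lam by rewrite divr_gt0// mulr_gt0.
have lam2 : lam <= 1 / 2.
  by rewrite /lam ler_pdivrMr ?mulr_gt0//; clear -rad_rho rad0; lra.
have lamE : lam * (8 * rad) = rho by rewrite /lam divfK// lt0r_neq0// mulr_gt0.
have [E E0 HE] := norm_le_coord v2rb.
pose C0 := \sum_i \sum_j `|v2r (y j) 0 i|.
have C00 : 0 <= C0 by apply: sumr_ge0 => i _; apply: sumr_ge0.
have yC i j : `|v2r (y j) 0 i| <= C0.
  rewrite /C0 (bigD1 i)//= (bigD1 j)//= -addrA lerDl.
  by rewrite addr_ge0// ?sumr_ge0// => ? _; rewrite sumr_ge0.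
pose B := 2 * C0 + 1.
have B0 : 0 < B by rewrite /B; clear -C00; lra.
have wB (w : seq I) i : `|v2r (digit_sum y lam w) 0 i| <= B.
  apply: (@le_trans _ _ (2 * C0)); last by rewrite /B; clear -C00; lra.
  apply: (@seminorm_digit_sum _ _ (fun v => `|v2r v 0 i|)) => //.
  - by move=> u v; rewrite linearD !mxE ler_normD.
  - by move=> c v; rewrite linearZZ !mxE normrM.
  - exact: ltW.
pose A := 8 * B * (E + 1) / rho + 1.
have A0 : 0 < A.
  rewrite /A ltr_wpDl// divr_ge0 ?[0 <= rho]ltW//.
  by rewrite mulr_ge0 ?addr_ge0// mulr_ge0 ?[0 <= B]ltW.
have key (J : nat) : (#|I|%:R ^+ J : R) <= (A / lam ^+ J) ^+ k.
  have lJ0 : 0 < lam ^+ J by exact: exprn_gt0.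
  (* Two vectors in one grid cell of side h are closer than two digit sums. *)
  pose h := lam ^+ J * rho / (4 * (E + 1)).
  have E1 : 0 < 4 * (E + 1) by clear -E0; lra.
  have h0 : 0 < h by rewrite /h divr_gt0// mulr_gt0.
  pose K := Num.truncn (2 * B / h).
  pose cell (w : J.-tuple I) : {ffun 'I_k -> 'I_K.+1} :=
    [ffun i => inord (Num.truncn ((v2r (digit_sum y lam w) 0 i + B) / h))].
  have cellK w i : nat_of_ord (cell w i) =
      Num.truncn ((v2r (digit_sum y lam w) 0 i + B) / h).
    rewrite ffunE inordK// ltnS; apply: le_truncn.
    rewrite ler_pM2r ?invr_gt0//.
    by have := wB w i; rewrite ler_norml => /andP[_]; clear; lra.
  have inj : injective cell.
    move=> w w' eqc; apply/val_inj/eqP/contraT => /= nw.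
    have := @digit_sum_separated _ _ (@Num.norm _ V) (@ler_normD _ _)
      (@normrZ _ _) _ y lam (ltW lam0) lam2 rad rho w w' (ltW rad0) (ltW rho0)
      yrad ysep lamE.
    rewrite !size_tuple => /(_ erefl nw) sep.
    have : `|digit_sum y lam w - digit_sum y lam w'| <= h * E.
      apply: HE; first exact: ltW.
      move=> i; apply: (@grid_cell_eq _ h B) => //; last by rewrite -!cellK eqc.
      - by have := wB w i; rewrite ler_norml => /andP[].
      - by have := wB w' i; rewrite ler_norml => /andP[].
    have hE : h * (4 * (E + 1)) = lam ^+ J * rho by rewrite /h divfK// lt0r_neq0.
    have := mulr_gt0 lJ0 rho0; clear -hE sep E0 h0 => lr le.
    have {sep}le : lam ^+ J * (rho / 2) <= h * E := le_trans sep le.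
    have : h * E < lam ^+ J * (rho / 2) by clear -hE E0 h0 lr; nra.
    by rewrite ltNge le.
  have := leq_card cell inj.
  rewrite card_tuple card_ffun !card_ord -(ler_nat R) !natrX => le1.
  apply: le_trans le1 _; apply: lerXn2r; rewrite ?nnegrE ?ler0n//.
    by rewrite divr_ge0 ?[0 <= A]ltW ?[0 <= lam ^+ J]ltW.
  rewrite -natr1 /K.
  have Bh0 : 0 <= 2 * B / h.
    by apply: divr_ge0; [apply: mulr_ge0 => //|]; exact: ltW.
  have /andP[t1 _] := truncn_itv Bh0.
  apply: le_trans (lerD t1 (lexx 1)) _.
  have -> : 2 * B / h = 8 * B * (E + 1) / rho / lam ^+ J.
    have E10 : 0 < E + 1 by rewrite ltr_wpDl.
    by rewrite /h; field; rewrite !lt0r_neq0.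
  rewrite [A / _]mulrDl div1r; apply: lerD => //; rewrite invf_ge1//.
  apply: exprn_ile1; first exact: ltW.
  by clear -lam2; lra.
pose x := #|I|%:R * lam ^+ k.
have x1 : x <= 1.
  apply: (@bounded_powers_le1 _ _ (A ^+ k)).
    by rewrite mulr_ge0// exprn_ge0// ltW.
  move=> J; rewrite /x exprMn.
  have := key J; rewrite expr_div_n ler_pdivlMr ?exprn_gt0 ?exprn_gt0//.
  by rewrite -!exprM mulnC.
have -> : 8 * rad / rho = lam^-1 by rewrite /lam invf_div.
by rewrite exprVn -[leRHS]mul1r ler_pdivlMr ?exprn_gt0.
Qed.

Theorem packing_bound (R : realType) (V : normedModType R) (k : nat)
    (I : finType) (y : I -> V) (z : V) (rad rho : R) :
    has_dim V k -> 0 < rho -> (1 < #|I|)%N ->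
    (forall i, `|y i - z| <= rad) ->
    (forall i j, i != j -> rho <= `|y i - y j|) ->
  #|I|%:R <= (8 * rad / rho) ^+ k.
Proof.
move=> /has_dim_coord[v2r v2rb] rho0 I1 yrad ysep.
apply: (@packing_centered _ V k v2r I (fun i => y i - z)) => // i j ij.
by rewrite opprB addrA subrK ysep.
Qed.

(** * Coordinates in a well-conditioned basis *)

(** Cramer's rule, for the replacement of a row. *)
Lemma cramer_row (R : comUnitRingType) (k : nat) (B B' : 'M[R]_k) (j : 'I_k) :
    B \in unitmx -> (forall i, i != j -> row i B' = row i B) ->
  (row j B' *m invmx B) 0 j * \det B = \det B'.
Proof.
move=> Bu eqB; rewrite (expand_det_row B' j).
have cof l : cofactor B' j l = cofactor B j l.
  congr (_ * \det _); apply/matrixP => i i'; rewrite !mxE.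
  have /rowP/(_ (lift l i')) : row (lift j i) B' = row (lift j i) B.
    by apply: eqB; rewrite eq_sym neq_lift.
  by rewrite !mxE.
transitivity ((row j B' *m invmx B *m (B *m \adj B)) 0 j).
  by rewrite mul_mx_adj mul_mx_scalar [RHS]mxE mulrC.
rewrite mulmxA mulmxKV// mxE; apply: eq_bigr => l _.
by rewrite !mxE cof.
Qed.

(** Choose the rows so that the determinant is maximal in absolute value: by
    Cramer's rule a coordinate is a ratio of determinants, the denominator
    being the maximal one. *)
Lemma max_det_coords (R : realFieldType) (k : nat) (I : finType)
    (g : I -> 'rV[R]_k) (s0 : {ffun 'I_k -> I}) :
    \det (\matrix_i g (s0 i)) != 0 ->
  exists s : {ffun 'I_k -> I}, \matrix_i g (s i) \in unitmx /\
    forall x j, `|(g x *m invmx (\matrix_i g (s i))) 0 j| <= 1.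
Proof.
move=> s00; pose d (s : {ffun 'I_k -> I}) := `|\det (\matrix_i g (s i))|.
have [s _ smax] := @Order.TotalTheory.arg_maxP _ _ _ s0 xpredT d isT.
have ds0 : 0 < d s by apply: lt_le_trans (smax s0 isT); rewrite normr_gt0.
have su : \matrix_i g (s i) \in unitmx.
  by rewrite unitmxE unitfE -normr_gt0.
exists s; split => // x j.
pose s' : {ffun 'I_k -> I} := [ffun i => if i == j then x else s i].
have := @cramer_row _ _ _ (\matrix_i g (s' i)) j su.
rewrite rowK ffunE eqxx => cr.
rewrite -(ler_pM2r ds0) mul1r -normrM cr; first exact: smax.
by move=> i ij; rewrite !rowK ffunE (negPf ij).
Qed.

(** The values of [h] need not span [V], so short multiples [w i] of a basis
    are added to the candidates before the determinant is maximized. *)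
Lemma barycentric_coords (R : realType) (V : normedModType R) (k : nat)
    (T : finType) (h : T -> V) (D : R) :
    has_dim V k -> 0 < D -> (forall x, `|h x| <= D) ->
  exists (b : 'I_k -> V) (c : 'I_k -> T -> R),
    [/\ forall i, `|b i| <= D, forall i x, `|c i x| <= 1 &
        forall x, h x = \sum_i c i x *: b i].
Proof.
move=> /has_dim_coord[v2r [r2v vK rK]] D0 hD.
pose e (i : 'I_k) : V := r2v (delta_mx 0 i).
pose w i : V := (D / (1 + `|e i|)) *: e i.
have e1 i : 0 < 1 + `|e i| by rewrite ltr_pwDl.
have wD i : `|w i| <= D.
  have De0 : 0 < D / (1 + `|e i|) by exact: divr_gt0.
  rewrite normrZ gtr0_norm// -mulrA ger_pMr//.
  by rewrite mulrC ler_pdivrMr// mul1r lerDr.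
pose p (y : T + 'I_k) : V := match y with inl x => h x | inr i => w i end.
have pD y : `|p y| <= D by case: y => [x|i] /=.
have [|s [su sc]] := @max_det_coords _ _ _ (v2r \o p) [ffun i => inr i].
  have -> : (\matrix_i (v2r \o p) ([ffun i => inr i] i) : 'M[R]_k) =
      diag_mx (\row_i (D / (1 + `|e i|))).
    apply/row_matrixP => i; rewrite rowK /= ffunE /= linearZZ rK row_diag_mx.
    by rewrite mxE.
  by rewrite det_diag; apply/prodf_neq0 => i _; rewrite mxE lt0r_neq0 ?divr_gt0.
pose B := \matrix_i (v2r \o p) (s i).
exists (p \o s), (fun i x => (v2r (h x) *m invmx B) 0 i); split.
- by move=> i; exact: pD.
- by move=> i x; exact: (sc (inl x)).
- move=> x; apply: (can_inj vK); rewrite -[LHS](mulmxKV su) linear_sum.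
  rewrite mulmx_sum_row; apply: eq_bigr => i _.
  by rewrite linearZZ rowK.
Qed.

(** * Averages along lines and the decay of energy *)

Definition dot (R : realType) (X : finType) (u v : {ffun X -> R}) : R :=
  \sum_x u x * v x.

Section Projections.
Variables (R : realType) (X : finType) (S : eqType).
Variable P : S -> {ffun X -> R} -> {ffun X -> R}.
Hypothesis PB : forall s u v, P s (u - v) = P s u - P s v.
Hypothesis Psym : forall s u v, dot (P s u) v = dot u (P s v).
Hypothesis Pidem : forall s u, P s (P s u) = P s u.
Hypothesis Pcomm : forall s t u, P s (P t u) = P t (P s u).

Let P0 s : P s 0 = 0.
Proof. by rewrite -[in LHS](subrr 0) PB subrr. Qed.

Lemma dot_ge0 (u : {ffun X -> R}) : 0 <= dot u u.
Proof. by apply: sumr_ge0 => x _; rewrite -expr2 sqr_ge0. Qed.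

Lemma dot_pythagoras (u v : {ffun X -> R}) :
  dot v (u - v) = 0 -> dot u u = dot v v + dot (u - v) (u - v).
Proof.
move=> uv; rewrite -[LHS]subr0 -[0 in LHS](mulr0 2) -uv.
rewrite /dot mulr_sumr -sumrB -big_split/=.
by apply: eq_bigr => x _; rewrite !ffunE; ring.
Qed.

Lemma foldr_proj_comm s u T : foldr P (P s u) T = P s (foldr P u T).
Proof. by elim: T => //= t T ->; exact: Pcomm. Qed.

Lemma foldr_projB u v T : foldr P (u - v) T = foldr P u T - foldr P v T.
Proof. by elim: T => //= t T ->; exact: PB. Qed.

(** On a common eigenvector of the commuting projections, with eigenvalues 0
    or 1, at most [m] of the eigenvalues are 1, because a product of [m.+1] of
    them vanishes. Instead of diagonalizing, split [u] into [a = P s0 u] and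
    [b = u - a] and use induction on the list: the other projections preserve
    the splitting, and [m] of them already annihilate [a]. *)
Lemma proj_energy (ss : seq S) (m : nat) (u : {ffun X -> R}) :
    (forall T, subseq T ss -> size T = m.+1 -> foldr P u T = 0) ->
  \sum_(s <- ss) dot (P s u) (P s u) <= m%:R * dot u u.
Proof.
elim: ss m u => [|s0 ss IH] m u kill.
  by rewrite big_nil mulr_ge0 ?dot_ge0.
pose a := P s0 u; pose b := u - a.
have Pb : P s0 b = 0 by rewrite /b PB Pidem subrr.
have split_energy s : dot (P s u) (P s u) =
    dot (P s a) (P s a) + dot (P s b) (P s b).
  rewrite (@dot_pythagoras _ (P s a)) -PB//.
  rewrite {1}/a Pcomm Psym Pcomm -/b Pb P0.
  by rewrite /dot big1// => x _; rewrite ffunE mulr0.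
have split_norm : dot u u = dot a a + dot b b.
  rewrite (@dot_pythagoras _ a)// {1}/a Psym Pb.
  by rewrite /dot big1// => x _; rewrite ffunE mulr0.
have Pa : \sum_(s <- ss) dot (P s a) (P s a) + dot a a <= m%:R * dot a a.
  case: m kill => [|m] kill.
    have a0 : a = 0.
      by apply: (kill [:: s0]) => //; rewrite sub1seq mem_head.
    rewrite a0 big1 => [|s _]; last first.
      by rewrite P0 /dot big1// => x _; rewrite ffunE mulr0.
    by rewrite add0r mul0r /dot big1// => x _; rewrite ffunE mulr0.
  rewrite -[m.+1]addn1 natrD mulrDl mul1r lerD2r; apply: IH => T Tss sT.
  rewrite foldr_proj_comm; apply: (kill (s0 :: T)); last by rewrite /= sT.
  by rewrite /= eqxx.
have Pb' : \sum_(s <- ss) dot (P s b) (P s b) <= m%:R * dot b b.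
  apply: IH => T Tss sT; rewrite foldr_projB foldr_proj_comm.
  rewrite (kill T) ?P0 ?subrr//.
  by apply: subseq_trans Tss _; exact: subseq_cons.
rewrite big_cons (eq_bigr _ (fun s _ => split_energy s)) big_split /=.
rewrite split_norm mulrDr -/a.
have -> : dot a a + (\sum_(s <- ss) dot (P s a) (P s a) +
  \sum_(s <- ss) dot (P s b) (P s b)) =
  (\sum_(s <- ss) dot (P s a) (P s a) + dot a a) +
  \sum_(s <- ss) dot (P s b) (P s b) by ring.
exact: (lerD Pa Pb').
Qed.

End Projections.

Section LineAverages.
Variables (R : realType) (K : finFieldType) (m : nat).
Local Notation X := 'rV[K]_m.
Implicit Types (s t : K) (x y : X) (u w : {ffun X -> R}).

(** A point of the moment curve: any [m] of them with distinct parameters form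
    a basis. *)
Definition moment_dir s : X := \row_j s ^+ j.

Definition line_avg s u : {ffun X -> R} :=
  [ffun x => #|K|%:R^-1 * \sum_t u (x + t *: moment_dir s)].

Let q0 : #|K|%:R != 0 :> R.
Proof. by rewrite pnatr_eq0 -lt0n; apply/card_gt0P; exists 0. Qed.

Lemma line_avgB s u w : line_avg s (u - w) = line_avg s u - line_avg s w.
Proof.
apply/ffunP => x; rewrite !ffunE -mulrBr -sumrB; congr (_ * _).
by apply: eq_bigr => t _; rewrite !ffunE.
Qed.

Lemma line_avg_sym s u w : dot (line_avg s u) w = dot u (line_avg s w).
Proof.
transitivity (#|K|%:R^-1 *
    \sum_t \sum_x u (x + t *: moment_dir s) * w x).
  rewrite exchange_big /= mulr_sumr; apply: eq_bigr => x _.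
  by rewrite ffunE -mulrA mulr_suml.
transitivity (#|K|%:R^-1 * \sum_t \sum_x u x * w (x + t *: moment_dir s)).
  congr (_ * _); rewrite (reindex_inj oppr_inj); apply: eq_bigr => t _.
  rewrite (reindex_inj (addIr (t *: moment_dir s))); apply: eq_bigr => x _ /=.
  by rewrite scaleNr addrK.
rewrite exchange_big /= mulr_sumr; apply: eq_bigr => x _.
by rewrite ffunE -mulr_sumr mulrCA.
Qed.

Definition invariant_along u s :=
  forall x t, u (x + t *: moment_dir s) = u x.

Lemma line_avg_invariant s u : invariant_along (line_avg s u) s.
Proof.
move=> x t; rewrite !ffunE; congr (_ * _).
rewrite [RHS](reindex_inj (addrI t)); apply: eq_bigr => t' _.
by rewrite scalerDl addrA.
Qed.

Lemma line_avg_id s u : invariant_along u s -> line_avg s u = u.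
Proof.
move=> us; apply/ffunP => x; rewrite ffunE (eq_bigr (fun=> u x)) => [|t _].
  by rewrite sumr_const -[u x *+ _]mulr_natl mulKf.
exact: us.
Qed.

Lemma line_avg_idem s u : line_avg s (line_avg s u) = line_avg s u.
Proof. exact: line_avg_id (@line_avg_invariant s u). Qed.

Lemma line_avg_preserves s s' u :
  invariant_along u s' -> invariant_along (line_avg s u) s'.
Proof.
move=> us x t; rewrite !ffunE; congr (_ * _); apply: eq_bigr => t' _.
by rewrite addrAC us.
Qed.

Lemma line_avg_comm s s' u :
  line_avg s (line_avg s' u) = line_avg s' (line_avg s u).
Proof.
apply/ffunP => x; rewrite !ffunE; congr (_ * _).
under eq_bigr do rewrite ffunE.
under [RHS]eq_bigr do rewrite ffunE.
rewrite -!mulr_sumr; congr (_ * _); rewrite exchange_big.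
by apply: eq_bigr => t _; apply: eq_bigr => t' _; rewrite addrAC.
Qed.

Lemma line_avg_sum s u : \sum_x line_avg s u x = \sum_x u x.
Proof.
under eq_bigr do rewrite ffunE.
rewrite -mulr_sumr exchange_big /= (eq_bigr (fun=> \sum_x u x)) => [|t _].
  by rewrite sumr_const -[(\sum_x _) *+ _]mulr_natl mulKf.
by rewrite [RHS](reindex_inj (addIr (t *: moment_dir s))).
Qed.

Lemma foldr_line_avg_invariant T u s :
  s \in T -> invariant_along (foldr line_avg u T) s.
Proof.
elim: T => //= s' T IH; rewrite in_cons => /orP[/eqP ->|/IH].
  exact: line_avg_invariant.
exact: line_avg_preserves.
Qed.

Lemma moment_curve_span (T : seq K) : uniq T -> size T = m ->
  forall x, exists c : 'I_m -> K, x = \sum_i c i *: moment_dir (nth 0 T i).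
Proof.
move=> uT sT x; pose A : 'M[K]_m := \matrix_i moment_dir (nth 0 T i).
have Au : A \in unitmx.
  rewrite unitmxE unitfE -det_tr.
  have -> : A^T = Vandermonde m (\row_i nth 0 T i).
    by apply/matrixP => i j; rewrite !mxE.
  rewrite det_Vandermonde; apply/prodf_neq0 => i _; apply/prodf_neq0 => j ij.
  rewrite !mxE subr_eq0 nth_uniq ?sT//; apply/eqP => ji.
  by rewrite ji ltnn in ij.
exists (fun i => (x *m invmx A) 0 i).
rewrite -[LHS](mulmxKV Au) mulmx_sum_row.
by apply: eq_bigr => i _; rewrite rowK.
Qed.

(** The iterated average is invariant under translation by [m] independent
    directions, hence constant, and it has the same sum as [u]. *)
Lemma foldr_line_avg_eq0 (T : seq K) u : uniq T -> size T = m ->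
  \sum_x u x = 0 -> foldr line_avg u T = 0.
Proof.
move=> uT sT u0; set w := foldr line_avg u T.
have w0 : \sum_x w x = 0.
  by rewrite /w -[RHS]u0; elim: (T) => //= s T' IH; rewrite line_avg_sum.
have wc x : w x = w 0.
  have [c ->] := moment_curve_span uT sT x.
  rewrite -[\sum_i _]add0r; elim/big_rec: _ => [|i y _ IH]; first by rewrite addr0.
  rewrite addrCA addrC (@foldr_line_avg_invariant T u)//.
  by rewrite mem_nth// sT.
move: w0; rewrite (eq_bigr _ (fun x _ => wc x)) sumr_const => /eqP.
rewrite mulrn_eq0 => /orP[|/eqP w00].
  by rewrite -leqn0 leqNgt => /negP[]; apply/card_gt0P; exists 0.
by apply/ffunP => x; rewrite wc w00 ffunE.
Qed.

End LineAverages.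

Lemma line_avg_energy (R : realType) (K : finFieldType) (m : nat)
    (u : {ffun 'rV[K]_m.+1 -> R}) : \sum_x u x = 0 ->
  \sum_s dot (line_avg s u) (line_avg s u) <= m%:R * dot u u.
Proof.
move=> u0; rewrite -big_enum; apply: proj_energy.
- exact: line_avgB.
- exact: line_avg_sym.
- exact: line_avg_idem.
- exact: line_avg_comm.
- move=> T Tss sT; apply: foldr_line_avg_eq0 => //.
  exact: subseq_uniq Tss (enum_uniq _).
Qed.

(** * Concentration of Lipschitz images *)

Lemma markov_count (R : realType) (X : finType) (F : X -> R) (eta : R) :
    (forall x, 0 <= F x) -> 0 < eta -> 2 * \sum_x F x <= #|X|%:R * eta ->
  (#|X| <= 2 * #|[set x | (F x <= eta)%R]|)%N.
Proof.
move=> F0 eta0 sF; set G := [set x | F x <= eta].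
have bad : #|~: G|%:R * eta <= \sum_x F x.
  rewrite (bigID (mem G)) /= -[leLHS]add0r; apply: lerD; first exact: sumr_ge0.
  rewrite mulr_natl -sumr_const.
  rewrite [leLHS](eq_bigl (fun x => x \notin G)) => [|x]; last by rewrite inE.
  apply: ler_sum => x; rewrite inE -ltNge; exact: ltW.
have : (2 * #|~: G|%:R : R) <= #|X|%:R.
  rewrite -(ler_pM2r eta0) -mulrA; apply: le_trans sF.
  by rewrite ler_pM2l.
rewrite -natrM ler_nat => le1; have := cardsC G; lia.
Qed.

Lemma sum_sqr_centered (R : realType) (X : finType) (c : X -> R) (mu : R) :
    #|X|%:R * mu = \sum_x c x -> (forall x, `|c x| <= 1) ->
  \sum_x (c x - mu) ^+ 2 <= #|X|%:R.
Proof.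
move=> cmu c1.
have -> : \sum_x (c x - mu) ^+ 2 = \sum_x c x ^+ 2 - #|X|%:R * mu ^+ 2.
  transitivity (\sum_x (c x ^+ 2 - c x * (2 * mu) + mu ^+ 2)).
    by apply: eq_bigr => x _; ring.
  rewrite big_split sumrB /= -mulr_suml -cmu sumr_const -[mu ^+ 2 *+ _]mulr_natl.
  by ring.
apply: (@le_trans _ _ (\sum_x c x ^+ 2)).
  by rewrite gerBl mulr_ge0 ?sqr_ge0.
rewrite -sum1_card natr_sum; apply: ler_sum => x _.
by rewrite -real_normK ?num_real// expr_le1.
Qed.

(** By averaging over [s], some direction makes the line averages of all
    centered coordinates small in mean square; Markov's inequality makes them
    small at half of the points. The lower bound on [#|K|] is what is needed for
    the resulting error, at most [k] coordinates times basis vectors of norm at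
    most [D], to be at most [beta]. *)
Theorem concentration (R : realType) (K : finFieldType) (m k : nat)
    (V : normedModType R) (f : 'rV[K]_m.+1 -> V) (beta D : R) :
    has_dim V k -> (0 < k)%N -> 0 < beta -> 0 < D ->
    (forall x s t, `|f (x + t *: moment_dir m.+1 s) - f x| <= beta) ->
    (forall x, `|f x - f 0| <= D) ->
    2 * m%:R * k%:R ^+ 3 * D ^+ 2 <= #|K|%:R * beta ^+ 2 ->
  exists z, (#|{: 'rV[K]_m.+1}| <= 2 * #|[set x | (`|f x - z| <= 2 * beta)%R]|)%N.
Proof.
move=> Vk k0 beta0 D0 fline fD big_q.
have [b [c [bD c1 hE]]] := barycentric_coords Vk D0 fD.
pose N : R := #|{: 'rV[K]_m.+1}|%:R.
have N0 : 0 < N by rewrite ltr0n; apply/card_gt0P; exists 0.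
have q0 : 0 < #|K|%:R :> R by rewrite ltr0n; apply/card_gt0P; exists 0.
have kR0 : 0 < k%:R :> R by rewrite ltr0n.
pose mu i : R := N^-1 * \sum_x c i x.
pose u i : {ffun 'rV[K]_m.+1 -> R} := [ffun x => c i x - mu i].
have muE i : N * mu i = \sum_x c i x by rewrite mulVKf ?lt0r_neq0.
have u0 i : \sum_x u i x = 0.
  under eq_bigr do rewrite ffunE.
  by rewrite sumrB sumr_const -[mu i *+ _]mulr_natl muE subrr.
have uu i : dot (u i) (u i) <= N.
  apply: le_trans (sum_sqr_centered (muE i) (c1 i)).
  by apply: ler_sum => x _; rewrite ffunE expr2.
pose E s : R := \sum_i dot (line_avg s (u i)) (line_avg s (u i)).
have sumE : \sum_s E s <= k%:R * (m%:R * N).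
  rewrite /E exchange_big /= mulr_natl -[k in leRHS]card_ord -sumr_const.
  apply: ler_sum => i _; apply: le_trans (line_avg_energy (u0 i)) _.
  exact: ler_wpM2l.
have [s Es] : exists s, #|K|%:R * E s <= k%:R * (m%:R * N).
  apply/existsP; rewrite -[[exists _, _]]negbK negb_exists; apply/negP => /forallP H.
  have : \sum_(s : K) (k%:R * (m%:R * N)) < \sum_s #|K|%:R * E s.
    apply: ltr_sum => [|s _]; last by rewrite ltNge.
    by apply/hasP; exists 0 => //; exact: mem_index_enum.
  rewrite sumr_const -[_ *+ _]mulr_natl -mulr_sumr ltr_pM2l// ltNge sumE//.
(* With coordinates at most beta / (k D), the sum over the basis is <= beta. *)
pose eta : R := (beta / (k%:R * D)) ^+ 2.
have kD0 : 0 < k%:R * D by rewrite mulr_gt0.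
have r0 : 0 < beta / (k%:R * D) by rewrite divr_gt0.
have eta0 : 0 < eta by rewrite exprn_gt0.
have small : 2 * \sum_x \sum_i line_avg s (u i) x ^+ 2 <= N * eta.
  have -> : \sum_x \sum_i line_avg s (u i) x ^+ 2 = E s.
    rewrite exchange_big; apply: eq_bigr => i _.
    by apply: eq_bigr => x _; rewrite expr2.
  rewrite -(ler_pM2l q0) mulrCA.
  apply: (@le_trans _ _ (2 * (k%:R * (m%:R * N)))); first by rewrite ler_pM2l.
  rewrite /eta expr_div_n !mulrA ler_pdivlMr ?exprn_gt0//.
  have -> : 2 * k%:R * m%:R * N * (k%:R * D) ^+ 2 =
    N * (2 * m%:R * k%:R ^+ 3 * D ^+ 2) by ring.
  have -> : #|K|%:R * N * beta * beta = N * (#|K|%:R * beta ^+ 2) by ring.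
  by rewrite ler_pM2l.
exists (f 0 + \sum_i mu i *: b i).
have := @markov_count _ _ (fun x => \sum_i line_avg s (u i) x ^+ 2) eta _ eta0 small.
move=> /(_ (fun x => sumr_ge0 _ (fun i _ => sqr_ge0 _))) /leq_trans; apply.
rewrite leq_mul2l /=; apply/subset_leq_card/fintype.subsetP => x; rewrite !inE => good.
have avg_small : `|\sum_i line_avg s (u i) x *: b i| <= beta.
  apply: le_trans (ler_norm_sum _ _ _) _.
  apply: (@le_trans _ _ (\sum_(i < k) (beta / (k%:R * D) * D))).
    apply: ler_sum => i _; rewrite normrZ; apply: ler_pM => //.
    rewrite -ler_sqr ?nnegrE ?normr_ge0 ?(ltW r0)//.
    rewrite real_normK ?num_real//; apply: le_trans good.
    by rewrite (bigD1 i)//= lerDl sumr_ge0// => j _; rewrite sqr_ge0.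
  rewrite sumr_const card_ord -[_ *+ _]mulr_natl.
  have -> : k%:R * (beta / (k%:R * D) * D) = beta by field; rewrite !lt0r_neq0.
  by [].
have avgE : \sum_i line_avg s (u i) x *: b i =
    #|K|%:R^-1 *: (\sum_t (f (x + t *: moment_dir m.+1 s) - f 0)) -
    \sum_i mu i *: b i.
  under [in RHS]eq_bigr do rewrite hE.
  rewrite exchange_big scaler_sumr -sumrB; apply: eq_bigr => i _.
  rewrite ffunE -scaler_suml scalerA -scalerBl; congr (_ *: _).
  under eq_bigr do rewrite ffunE.
  rewrite sumrB sumr_const mulrBr -[mu i *+ _]mulr_natl mulKf ?lt0r_neq0//.
have lineE : #|K|%:R^-1 *: (\sum_t (f (x + t *: moment_dir m.+1 s) - f 0)) =
    (f x - f 0) + #|K|%:R^-1 *: \sum_t (f (x + t *: moment_dir m.+1 s) - f x).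
  rewrite !sumrB !sumr_const !scalerBr -[f 0 *+ _]scaler_nat.
  rewrite -[f x *+ _]scaler_nat !scalerA mulVf ?lt0r_neq0// !scale1r.
  by rewrite [RHS]addrC addrA subrK.
have line_small :
    `|#|K|%:R^-1 *: \sum_t (f (x + t *: moment_dir m.+1 s) - f x)| <= beta.
  rewrite normrZ ger0_norm ?invr_ge0// ler_pdivrMl//.
  apply: le_trans (ler_norm_sum _ _ _) _.
  by rewrite mulr_natl -sumr_const; exact: ler_sum.
have -> : f x - (f 0 + \sum_i mu i *: b i) =
    \sum_i line_avg s (u i) x *: b i -
    #|K|%:R^-1 *: \sum_t (f (x + t *: moment_dir m.+1 s) - f x).
  by rewrite avgE lineE opprD addrA [RHS]addrAC addrK.
apply: le_trans (ler_normB _ _) _.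
by rewrite [2 * _]mulr_natl mulr2n lerD.
Qed.

(** * The truncated word metric *)

Section WordNorm.
Variables (G : finZmodType) (S : {set G}).
Hypothesis S0 : 0 \in S.
Hypothesis SN : forall z, z \in S -> - z \in S.

Fixpoint word_ball (j : nat) : {set G} :=
  if j is j'.+1 then [set y + z | y in word_ball j', z in S] else [set 0].

Lemma card_word_ball j : (#|word_ball j| <= #|S| ^ j)%N.
Proof.
elim: j => [|j IH] /=; first by rewrite cards1 expn0.
rewrite expnSr; apply: leq_trans (leq_mul IH (leqnn _)).
by rewrite curry_imset2X -cardsX leq_imset_card.
Qed.

Lemma word_ball_sub i j : (i <= j)%N -> word_ball i \subset word_ball j.
Proof.
move=> /subnK <-; elim: (j - i)%N => [|d IH] //.
apply: (fintype.subset_trans IH); apply/fintype.subsetP => z zd.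
by rewrite addSn /= -[z]addr0; apply: imset2_f.
Qed.

Lemma word_ballN j z : z \in word_ball j -> - z \in word_ball j.
Proof.
elim: j z => [|j IH] z /=; first by rewrite !inE oppr_eq0.
case/imset2P => y s yj sS ->; rewrite opprD.
by apply: imset2_f; [exact: IH|exact: SN].
Qed.

Lemma word_ballD i j y z :
  y \in word_ball i -> z \in word_ball j -> y + z \in word_ball (i + j).
Proof.
move=> yi; elim: j z => [|j IH] z /=.
  by rewrite inE => /eqP ->; rewrite addr0 addn0.
case/imset2P => w s wj sS ->; rewrite addnS /= addrA.
by apply: imset2_f => //; exact: IH.
Qed.

(** The word length truncated at [r]: since the balls increase, this counts the
    radii below [r] that are too small. *)
Definition word_norm (r : nat) (z : G) : nat := \sum_(j < r) (z \notin word_ball j).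

Lemma word_norm_le r z : (word_norm r z <= r)%N.
Proof.
rewrite -[leqRHS]card_ord -sum1_card; apply: leq_sum => j _; exact: leq_b1.
Qed.

Lemma word_norm_ball r j z : z \in word_ball j -> (word_norm r z <= j)%N.
Proof.
move=> zj; have [rj|jr] := leqP r j; first exact: leq_trans (word_norm_le _ _) rj.
rewrite /word_norm (bigID (fun i : 'I_r => (i < j)%N)) /=.
rewrite [X in (_ + X)%N]big1 ?addn0 => [|i]; last first.
  by rewrite -leqNgt => /word_ball_sub/fintype.subsetP -> //.
rewrite (leq_trans (leq_sum _ (fun i _ => leq_b1 _)))//.
rewrite (big_ord_narrow (ltnW jr)) sum1_card card_ord//.
Qed.

Lemma word_norm_inball r z :
  (word_norm r z < r)%N -> z \in word_ball (word_norm r z).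
Proof.
set j := word_norm r z => jr; apply: contraLR (leqnn j) => zj.
rewrite -ltnNge {2}/j /word_norm (bigID (fun i : 'I_r => (i <= j)%N)) /=.
rewrite (eq_bigr (fun=> 1%N)) => [|i ij]; last first.
  by rewrite (contra _ zj)//; exact: (fintype.subsetP (word_ball_sub ij)).
by rewrite (big_ord_narrow jr (F := fun=> 1%N)) sum1_card card_ord leq_addr.
Qed.

Lemma word_norm_eq0 r z : (0 < r)%N -> (word_norm r z == 0) = (z == 0).
Proof.
move=> r0; apply/eqP/eqP => [z0|->].
  have := @word_norm_inball r z; rewrite z0 => /(_ r0).
  by rewrite inE => /eqP.
by apply/eqP; rewrite -leqn0; apply: word_norm_ball; rewrite inE.
Qed.

Lemma word_normN r z : word_norm r (- z) = word_norm r z.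
Proof.
apply: eq_bigr => j _; congr (nat_of_bool (~~ _)).
by apply/idP/idP => [/word_ballN|/word_ballN //]; rewrite opprK.
Qed.

Lemma word_normD r y z :
  (word_norm r (y + z)%R <= word_norm r y + word_norm r z)%N.
Proof.
have [yr|yr] := leqP r (word_norm r y).
  by rewrite (leq_trans (word_norm_le _ _))// (leq_trans yr)// leq_addr.
have [zr|zr] := leqP r (word_norm r z).
  by rewrite (leq_trans (word_norm_le _ _))// (leq_trans zr)// leq_addl.
by apply/word_norm_ball/word_ballD; exact: word_norm_inball.
Qed.

Lemma word_norm_gen r z : z \in S -> (word_norm r z <= 1)%N.
Proof.
move=> zS; apply: word_norm_ball; rewrite /= -[z]add0r.
by apply: imset2_f => //; rewrite inE.
Qed.

Lemma card_word_norm_lt r : (#|[set z | (word_norm r z < r)%N]| <= #|S| ^ r)%N.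
Proof.
apply: leq_trans (card_word_ball r); apply/subset_leq_card/fintype.subsetP => z.
rewrite inE => zr.
exact: (fintype.subsetP (word_ball_sub (ltnW zr)) _ (word_norm_inball zr)).
Qed.

(** The [p] additional points, at distance [r] from everything, adjust the
    cardinality of the space to a prescribed [n]. *)
Definition word_dist (p r : nat) (x y : G + 'I_p) : nat :=
  match x, y with
  | inl x', inl y' => word_norm r (x' - y')
  | _, _ => if x == y then 0%N else r
  end.

Lemma word_distxx p r (x : G + 'I_p) : word_dist r x x = 0%N.
Proof.
case: x => [x|i] /=; last by rewrite eqxx.
by apply/eqP; rewrite subrr -leqn0; apply: word_norm_ball; rewrite inE.
Qed.

Lemma word_dist_eq0 p r (x y : G + 'I_p) : (0 < r)%N ->
  word_dist r x y = 0%N -> x = y.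
Proof.
move=> r0; case: x y => [x|i] [y|j] /=.
- by move/eqP; rewrite word_norm_eq0// subr_eq0 => /eqP ->.
- by move=> r00; rewrite r00 in r0.
- by move=> r00; rewrite r00 in r0.
- by case: eqP => // _ r00; rewrite r00 in r0.
Qed.

Lemma word_dist_sym p r (x y : G + 'I_p) : word_dist r x y = word_dist r y x.
Proof.
case: x y => [x|i] [y|j] //=; last by rewrite eq_sym.
by rewrite -word_normN opprB.
Qed.

Lemma word_dist_le p r (x y : G + 'I_p) : (word_dist r x y <= r)%N.
Proof.
by case: x y => [x|i] [y|j] /=; rewrite ?word_norm_le//; case: ifP.
Qed.

Lemma word_dist_triangle p r (y x z : G + 'I_p) :
  (word_dist r x z <= word_dist r x y + word_dist r y z)%N.
Proof.
have [->|xy] := eqVneq x y; first by rewrite word_distxx.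
have [->|yz] := eqVneq y z; first by rewrite word_distxx addn0.
pose pad (u : G + 'I_p) := if u is inr _ then true else false.
have far u v : u != v -> pad u || pad v -> word_dist r u v = r.
  by case: u v => [u|i] [v|j] //= /negPf ->.
have [xr|xl] := boolP (pad x).
  by rewrite (far x y)// ?xr// (leq_trans (word_dist_le _ _ _))// leq_addr.
have [yr|yl] := boolP (pad y).
  by rewrite (far x y)// ?yr ?orbT// (leq_trans (word_dist_le _ _ _))// leq_addr.
have [zr|zl] := boolP (pad z).
  by rewrite (far y z)// ?zr ?orbT// (leq_trans (word_dist_le _ _ _))// leq_addl.
case: x y z {far xy yz} xl yl zl => [x|//] [y|//] [z|//] _ _ _ /=.
by apply: leq_trans (word_normD _ _ _); rewrite addrA subrK.
Qed.

End WordNorm.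

Lemma admissible_finite_metric (R : realType) (n : nat) (alpha : R) (k : nat)
    (T : finType) (d : T -> T -> nat) :
    admissible_dim n alpha k -> #|T| = n ->
    (forall x, d x x = 0%N) -> (forall x y, d x y = 0%N -> x = y) ->
    (forall x y, d x y = d y x) ->
    (forall y x z, (d x z <= d x y + d y z)%N) ->
  exists V : normedModType R, has_dim V k /\
    embeds_with_distortion (fun x y => (d x y)%:R) (@norm_dist R V) alpha.
Proof.
move=> adm Tn dxx d0 dC dT; pose dR x y : R := (d x y)%:R.
have dRxx x : dR x x = 0 by rewrite /dR dxx.
have dR0 x y : dR x y = 0 -> x = y.
  by move=> /eqP; rewrite pnatr_eq0 => /eqP/d0.
have dRC x y : dR x y = dR y x by rewrite /dR dC.
have dRT y x z : dR x z <= dR x y + dR y z by rewrite /dR -natrD ler_nat.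
pose M : metricType R := HB.pack T (isMetric.Build R T dRxx dR0 dRC dRT).
have Mn : ([set: M] #= `I_n)%card.
  apply: card_eq_trans (_ : [set: 'I_n] #= `I_n)%card; last first.
    by rewrite card_eq_sym; exact: card_II.
  rewrite -Tn; apply/card_bijP.
  exists (fun x => to_setT (enum_rank (val x : T))).
  exists (fun i => to_setT (enum_val (val i) : M)) => x; apply: val_inj => /=.
    by rewrite enum_rankK.
  by rewrite enum_valK.
exact: adm M Mn.
Qed.

(** * The dimension bound at a fixed scale *)

(** A maximal separated subset is also a net. *)
Lemma separated_subset (T : finType) (e : rel T) (G : {set T}) (b : nat) :
    reflexive e -> symmetric e -> (forall a, (#|[set x | e a x]| <= b)%N) ->
  exists A : {set T}, [/\ A \subset G,
    {in A &, forall x y, x != y -> ~~ e x y} & (#|G| <= #|A| * b)%N].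
Proof.
move=> er es eb.
pose P (A : {set T}) := (A \subset G) &&
  [forall x in A, forall y in A, (x != y) ==> ~~ e x y].
have [A /maxsetP[/andP[AG /forall_inP Asep] Amax]] : {A | maxset P A}.
  apply: ex_maxset; exists finset.set0; rewrite /P finset.sub0set /=.
  by apply/forall_inP => x; rewrite inE.
have {}Asep : {in A &, forall x y, x != y -> ~~ e x y}.
  by move=> x y xA yA xy; move/forall_inP: (Asep _ xA) => /(_ _ yA)/implyP; apply.
exists A; split => //.
have cover : G \subset \bigcup_(a in A) [set x | e a x].
  apply/fintype.subsetP => x xG; apply/finset.bigcupP.
  have [xA|xA] := boolP (x \in A); first by exists x; rewrite ?inE.
  apply/exists_inP; apply: contraNT xA; rewrite negb_exists_in => /forall_inP far.
  have -> : A = x |: A; last by rewrite finset.setU11.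
  apply/esym/Amax; last exact: finset.subsetUr.
  rewrite /P finset.subUset finset.sub1set xG AG /=.
  apply/forall_inP => u; rewrite finset.in_setU1 => uA.
  apply/forall_inP => v; rewrite finset.in_setU1 => vA; apply/implyP => uv.
  case/orP: uA vA uv => [/eqP ->|uA] /orP[/eqP ->|vA] uv.
  - by rewrite eqxx in uv.
  - by have := far _ vA; rewrite inE es.
  - by have := far _ uA; rewrite inE.
  - exact: Asep.
apply: leq_trans (subset_leq_card cover) _.
rewrite -sum_nat_const; elim/big_rec2: _ => [|a c B _ IH]; first by rewrite cards0.
by apply: leq_trans (leq_card_setU _ _) _; exact: leq_add.
Qed.

(** The space is [K^(4r)] with the word metric of the multiples of points of
    the moment curve. Half of its points go to a ball of radius [2 * alpha]
    (in units of [tau]); as the balls of radius less than [r] have at most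
    [#|K| ^ (2 * r)] points, that half contains [#|K| ^ (2 * r) / 2] points
    which are [r]-separated. *)
Lemma dimension_bound (R : realType) (K : finFieldType) (r n k : nat)
    (alpha : R) :
    (0 < r)%N -> (0 < k)%N -> (#|K| ^ (4 * r) <= n)%N -> 1 <= alpha ->
    (8 * r ^ 3 * k ^ 3 <= #|K|)%N -> admissible_dim n alpha k ->
  (#|K| ^ (2 * r))%:R <= 2 * (16 * alpha / r%:R) ^+ k.
Proof.
move=> r0 k0 qn alpha1 big_q adm.
pose m := (4 * r).-1.
have m1 : m.+1 = (4 * r)%N by rewrite /m prednK// muln_gt0.
pose S := [set t *: moment_dir m.+1 s | t in [set: K], s in [set: K]].
have inS t s : t *: moment_dir m.+1 s \in S by apply: imset2_f; rewrite inE.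
have S0 : 0 \in S by rewrite -(scale0r (moment_dir m.+1 (0 : K))) inS.
have SN z : z \in S -> - z \in S.
  by case/imset2P => t s _ _ ->; rewrite -scaleNr inS.
have cS : (#|S| <= #|K| ^ 2)%N.
  by rewrite /S curry_imset2X (leq_trans (leq_imset_card _ _))// cardsX !cardsT.
have cX : #|{: 'rV[K]_m.+1}| = (#|K| ^ (4 * r))%N by rewrite card_mx mul1n m1.
pose T : finType := ('rV[K]_m.+1 + 'I_(n - #|K| ^ (4 * r)))%type.
have [V [Vk [f [tau [tau0 fd]]]]] : exists V : normedModType R, has_dim V k /\
    embeds_with_distortion (fun x y : T => (word_dist S r x y)%:R) (@norm_dist R V)
      alpha.
  apply: admissible_finite_metric adm _ _ _ _ _.
  - by rewrite card_sum cX card_ord subnKC.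
  - exact: word_distxx.
  - by move=> x y; exact: word_dist_eq0.
  - exact: word_dist_sym.
  - exact: word_dist_triangle.
pose g (x : 'rV[K]_m.+1) := f (inl x).
have gd x y : tau * (word_norm S r (x - y))%:R <= `|g x - g y| <=
    alpha * tau * (word_norm S r (x - y))%:R 
  by exact: (fd (inl x) (inl y)).
have at0 : 0 < alpha * tau by rewrite mulr_gt0// (lt_le_trans _ alpha1).
have r0R : 0 < r%:R :> R by rewrite ltr0n.
have [||||z half] := @concentration R K m k V g (alpha * tau)
    (alpha * tau * r%:R) Vk k0 at0.
- exact: mulr_gt0.
- move=> x s t; have /andP[_ le1] := gd (x + t *: moment_dir m.+1 s) x.
  apply: le_trans le1 _; rewrite addrAC subrr add0r ger_pMr// lern1.
  exact: word_norm_gen.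
- move=> x; have /andP[_ le1] := gd x 0.
  by apply: le_trans le1 _; rewrite ler_pM2l// ler_nat word_norm_le.
- rewrite exprMn [_ ^+ 2 * _]mulrC mulrA ler_pM2r ?exprn_gt0//.
  rewrite -!natrX -!natrM ler_nat; apply: leq_trans big_q.
  have : (m <= 4 * r)%N by rewrite -m1.
  move=> mr; apply: (@leq_trans (2 * (4 * r) * k ^ 3 * r ^ 2)).
    by rewrite !leq_mul.
  by rewrite !expnS; lia.
set G := [set x | _] in half.
pose near (x y : 'rV[K]_m.+1) := (word_norm S r (y - x)%R < r)%N.
have [|||A [AG Asep GA]] := @separated_subset _ near G (#|S| ^ r).
- move=> x; rewrite /near subrr.
  by have /eqP -> : word_norm S r 0 == 0%N by rewrite word_norm_eq0.
- by move=> x y; rewrite /near -(word_normN SN) opprB.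
- move=> a; apply: leq_trans (card_word_norm_lt S0 r).
  rewrite -(card_imset _ (addIr (- a))); apply/subset_leq_card/fintype.subsetP.
  by move=> _ /imsetP[x xa ->]; rewrite inE in xa; rewrite inE.
have q1 : (1 < #|K|)%N.
  by apply/card_gt1P; exists 0, 1; rewrite !inE eq_sym oner_neq0.
have cA : (#|K| ^ (2 * r) <= 2 * #|A|)%N.
  rewrite -(@leq_pmul2r (#|K| ^ (2 * r))) ?expn_gt0 ?(ltnW q1)//.
  have -> : (#|K| ^ (2 * r) * #|K| ^ (2 * r))%N = #|{: 'rV[K]_m.+1}|.
    by rewrite -expnD cX; congr (_ ^ _)%N; lia.
  rewrite (leq_trans half)// -mulnA leq_pmul2l// (leq_trans GA)//.
  by rewrite leq_mul2l expnM leq_exp2r// cS orbT.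
have A1 : (1 < #|A|)%N.
  have : (2 ^ 2 <= #|K| ^ (2 * r))%N.
    rewrite expnM (leq_trans _ (leq_pexp2l _ r0)) ?expn1 ?expn_gt0 ?leq_exp2r//.
    by rewrite (ltnW q1).
  by lia.
apply: (@le_trans _ _ (2 * #|A|%:R)); first by rewrite -natrM ler_nat.
rewrite ler_pM2l//; pose I : finType := {x | x \in A}.
have cI : #|I| = #|A| by rewrite card_sig; apply: eq_card => x; rewrite inE.
have := @packing_bound R V k I (g \o val) z (2 * (alpha * tau)) (tau * r%:R) Vk.
rewrite cI mulr_gt0// => /(_ isT A1).
have -> : 8 * (2 * (alpha * tau)) / (tau * r%:R) = 16 * alpha / r%:R.
  by field; rewrite !lt0r_neq0.
apply.
- move=> [x xA] /=; have := fintype.subsetP AG _ xA; by rewrite inE.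
- move=> [x xA] [y yA] xy /=; have /andP[le1 _] := gd x y.
  apply: le_trans le1; rewrite ler_pM2l// ler_nat leqNgt.
  by apply: (Asep y x) => //; rewrite eq_sym.
Qed.

(** * Choice of the scale *)

Lemma admissible_dim_gt0 (R : realType) (n k : nat) (alpha : R) :
  (1 < n)%N -> admissible_dim n alpha k -> (0 < k)%N.
Proof.
move=> n1 adm; case: k adm => [|//] adm.
have [V [/has_dim_coord[v2r [r2v vK _]] [f [tau [tau0 fd]]]]] :
    exists V : normedModType R, has_dim V 0 /\
      embeds_with_distortion (fun x y : 'I_n => (x != y : nat)%:R)
        (@norm_dist R V) alpha.
  apply: admissible_finite_metric adm _ _ _ _ _.
  - exact: card_ord.
  - by move=> x; rewrite eqxx.
  - by move=> x y; case: eqVneq.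
  - by move=> x y; rewrite eq_sym.
  - move=> y x z; have [->|xy] := eqVneq x y; first by rewrite leq_addl.
    by rewrite (leq_trans (leq_b1 _))// leq_addr.
have /andP[] := fd (Ordinal (ltnW n1)) (Ordinal n1).
rewrite /norm_dist (_ : f _ = f (Ordinal n1)).
  by rewrite subrr normr0 /= mulr1 leNgt tau0.
by apply: (can_inj vK); apply/rowP => -[].
Qed.

Lemma ln2_bounds (R : realType) : 1 / 2 <= ln (2 : R) <= 1.
Proof.
apply/andP; split; last first.
  rewrite -ler_expR lnK ?posrE//; apply: le_trans (expR_ge1Dx 1); lra.
rewrite -ler_expR lnK ?posrE//.
have := expR_ge1Dx (- (1 / 2) : R); rewrite expRN => h.
rewrite -[leLHS]invrK invf_ple ?posrE ?invr_gt0 ?expR_gt0//.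
by apply: le_trans h; lra.
Qed.

Lemma expR1_le (R : realType) : expR (1 : R) <= 14 / 5.
Proof.
have h1 : (19 / 20 : R) <= expR (- (1 / 20)).
  by apply: le_trans (expR_ge1Dx _); lra.
have h2 : (19 / 20 : R) ^+ 20 <= expR (- (1 / 20)) ^+ 20.
  by apply: lerXn2r; rewrite ?nnegrE ?expR_ge0//; lra.
have h3 : expR (- (1 / 20) : R) ^+ 20 = (expR 1)^-1.
  by rewrite -expRM_natl -expRN; congr expR; lra.
have h4 : (5 / 14 : R) <= (19 / 20) ^+ 20 by lra.
rewrite -[leLHS]invrK invf_ple ?posrE ?invr_gt0 ?expR_gt0//.
by rewrite -h3 invf_div; exact: le_trans h2.
Qed.

(** This makes [ln (ln (ln n))] positive, and bounded away from 0, for all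
    [n >= 20]: it amounts to [e ^ e < 20]. *)
Lemma lnln20_gt1 (R : realType) : 1 < ln (ln (20 : R)).
Proof.
have h1 : ln (20 : R) > 14 / 5.
  have h : expR (14 : R) < 20 ^+ 5.
    have -> : expR (14 : R) = expR 1 ^+ 14 by rewrite -expRM_natl mulr1.
    apply: (@le_lt_trans _ _ ((14 / 5) ^+ 14)); last by lra.
    by apply: lerXn2r; rewrite ?nnegrE ?expR_ge0 ?expR1_le//; lra.
  have := h; rewrite -ltr_ln ?posrE ?expR_gt0 ?exprn_gt0//.
  by rewrite expRK lnXn// -mulr_natl => h'; lra.
rewrite -ltr_expR lnK; first by apply: le_lt_trans h1; exact: expR1_le.
by rewrite posrE; lra.
Qed.

(** Here [L] stands for log_2 n, [l] for log_2 log_2 n and [r] for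
    [L / (24 l)]. The field of cardinality [2 ^ (6 * l)], at least [L ^ 6],
    absorbs the factor [8 * r ^ 3 * k ^ 3]. *)
Lemma multiscale_bound (R : realType) (n k l L r : nat) (alpha : R) :
    (0 < r)%N -> (0 < k <= L)%N -> (L < 2 ^ l)%N -> (24 * l * r <= L)%N ->
    (2 ^ L <= n)%N -> 1 <= alpha -> admissible_dim n alpha k ->
  (6 * l * r)%:R * ln 2 <= k%:R * ln (16 * alpha / r%:R).
Proof.
move=> r0 /andP[k0 kL] Ll lrL Ln alpha1 adm.
have l0 : (0 < l)%N by case: l Ll {lrL} => // L0; move: k0; lia.
have [K _ cK] := @pPrimePowerField 2 (6 * l) isT (ltac:(by rewrite muln_gt0)).
have qn : (#|K| ^ (4 * r) <= n)%N.
  by rewrite cK -expnM (leq_trans _ Ln)// leq_exp2l//; lia.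
have big_q : (8 * r ^ 3 * k ^ 3 <= #|K|)%N.
  rewrite cK [(6 * l)%N]mulnC expnM.
  apply: (@leq_trans (L ^ 6)); last by rewrite leq_exp2r// ltnW.
  rewrite (_ : 6 = 3 + 3)%N// expnD mulnC leq_mul ?leq_exp2r//.
  rewrite (_ : 8 = 2 ^ 3)%N// -expnMn leq_exp2r//.
  by apply: leq_trans lrL; rewrite leq_mul2r; apply/orP; right; lia.
have := dimension_bound r0 k0 qn alpha1 big_q adm.
rewrite cK -expnM natrX => bound.
have r0R : 0 < r%:R :> R by rewrite ltr0n.
have X0 : 0 < 16 * alpha / r%:R.
  by rewrite divr_gt0// mulr_gt0// (lt_le_trans _ alpha1).
have pow_le : 2 ^+ (6 * l * r) <= (16 * alpha / r%:R) ^+ k.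
  rewrite -(ler_pM2l (ltr0n R 2)); apply: le_trans bound.
  by rewrite -exprS ler_eXn2l ?ltr1n//; nia.
rewrite [_ * ln 2]mulr_natl [k%:R * _]mulr_natl -!lnXn// ler_ln//.
all: by rewrite posrE exprn_gt0.
Qed.

(** The range where the scale [r] is 0, in which [n] is bounded. *)
Lemma small_log (l L : nat) :
  (2 ^ l.-1 <= L)%N -> (L < 24 * l)%N -> (L < 192)%N.
Proof.
move=> lL Ll; have [l8|l9] := leqP l 8; first by lia.
suff : (24 * l <= 2 ^ l.-1)%N by lia.
rewrite -(subnK l9); elim: (l - 9)%N => [//|d IH].
have -> : ((d.+1 + 9).-1 = (d + 9).-1.+1)%N by lia.
rewrite expnS; move: IH; set p := (2 ^ _)%N; lia.
Qed.

Theorem mainTheorem2 (R : realType) (a : R) (ha : 1 <= a) :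
  exists c : R, 0 < c /\
    forall (n : nat) (alpha : R), (20 <= n)%N -> 1 <= alpha ->
      1 / a * ln n%:R <= alpha <= a * ln n%:R ->
      (k_linf n alpha)%:R >= c * (ln n%:R / ln (ln (ln n%:R))).
Proof.
pose delta : R := ln (ln (ln 20)).
have lnln20 : 1 < ln (ln (20 : R)) := lnln20_gt1 R.
have delta0 : 0 < delta by exact: ln_gt0.
have a0 : 0 < a by lra.
have [M M1 ME] : exists2 M : R, 1 < M & M = 7680 * a.
  by exists (7680 * a) => //; lra.
have M0 : 0 < M by exact: lt_trans M1.
(* ln (M y) <= C ln y whenever ln y >= delta. *)
pose C := 1 + ln M / delta.
have a1 : 0 < ln M by exact: ln_gt0.
have C0 : 0 < C by rewrite /C addr_gt0// divr_gt0.
pose c := Num.min (delta / 192) (1 / (32 * C)).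
have c0 : 0 < c by rewrite lt_min !divr_gt0// mulr_gt0.
exists c; split => // n alpha n20 alpha1 /andP[_ alpha_le].
have [+ _] := k_linfP n alpha1; set k := k_linf n alpha => adm.
have k0 : (0 < k)%N by apply: admissible_dim_gt0 adm; exact: leq_trans n20.
have kR1 : 1 <= k%:R :> R by rewrite ler1n.
set x : R := ln n%:R; set y : R := ln x; set w : R := ln y.
have n0 : 0 < n%:R :> R by rewrite ltr0n (leq_trans _ n20).
have ln20 : 0 < ln (20 : R) by rewrite ln_gt0 ?ltr1n.
have x20 : ln 20 <= x by rewrite ler_ln ?posrE ?ler_nat.
have x0 : 0 < x by exact: lt_le_trans x20.
have y20 : ln (ln 20) <= y by rewrite ler_ln ?posrE.
have y1 : 1 < y by exact: lt_le_trans y20.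
have y0 : 0 < y by exact: lt_trans y1.
have w_delta : delta <= w by rewrite ler_ln ?posrE// (lt_trans _ lnln20).
have w0 : 0 < w by exact: lt_le_trans w_delta.
rewrite mulrA ler_pdivrMr//.
pose L := trunc_log 2 n; pose l := (trunc_log 2 L).+1.
pose r := (L %/ (24 * l))%N.
have /andP[Ln nL] : (2 ^ L <= n < 2 ^ L.+1)%N.
  by apply: trunc_log_bounds => //; exact: leq_trans n20.
have L0 : (0 < L)%N by rewrite trunc_log_gt0 (leq_trans _ n20).
have /andP[lL Ll] : (2 ^ l.-1 <= L < 2 ^ l)%N by exact: trunc_log_bounds.
have /andP[ln2l ln2u] := ln2_bounds R.
have xL : x <= L%:R + 1.
  have : x <= (L.+1)%:R * ln 2.
    rewrite mulr_natl -lnXn// ler_ln ?posrE ?exprn_gt0// -natrX ler_nat.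
    exact: ltnW.
  by rewrite -natr1; have : 0 <= L%:R :> R by []; clear -ln2u; nra.
(* Above log_2 n, the dimension is large enough for trivial reasons. *)
have [Lk|kL] := ltnP L k.
  have xk : x <= k%:R by apply: le_trans xL _; rewrite natr1 ler_nat.
  have cd : c <= delta.
    apply: (@le_trans _ _ (delta / 192)); first by rewrite ge_min lexx.
    by clear -delta0; lra.
  rewrite [leRHS]mulrC; apply: ler_pM => //; [exact: ltW|exact: ltW|].
  exact: le_trans cd w_delta.
(* For bounded n the bound k >= 1 suffices. *)
have [r_eq0|r0] := posnP r.
  have L192 : (L < 192)%N.
    by apply: small_log lL _; rewrite ltnNge -divn_gt0// -/r r_eq0.
  have x192 : x <= 192.
    by apply: le_trans xL _; rewrite natr1 ler_nat.
  apply: (@le_trans _ _ (delta / 192 * 192)).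
    by apply: ler_pM => //; [exact: ltW|exact: ltW|rewrite ge_min lexx].
  rewrite divfK//; apply: le_trans w_delta _.
  by rewrite -[leLHS]mul1r ler_pM2r.
have lrL : (24 * l * r <= L)%N by rewrite mulnC /r; exact: leq_trunc_div.
have LrU : (L < 48 * l * r)%N.
  apply: (@leq_trans (24 * l * r.+1)); first by rewrite mulnC /r ltn_ceil.
  by rewrite mulnS (mulnDl 24 24 l) mulnDl leq_add2r leq_pmulr.
have k0L : (0 < k <= L)%N by rewrite k0.
have := multiscale_bound r0 k0L Ll lrL Ln alpha1 adm.
set X := 16 * alpha / r%:R => scale_le.
have r0R : 0 < r%:R :> R by rewrite ltr0n.
have LR1 : 1 <= L%:R :> R by rewrite ler1n.
have lr_low : L%:R / 16 <= (6 * l * r)%:R * ln 2 :> R.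
  have : (L%:R : R) <= 8 * (6 * l * r)%:R by rewrite -natrM ler_nat !mulnA ltnW.
  by clear -ln2l LR1; nra.
have l_le : l%:R <= 5 * y.
  have lnL : (l.-1)%:R * ln 2 <= ln L%:R :> R.
    rewrite mulr_natl -lnXn// ler_ln ?posrE ?exprn_gt0 ?ltr0n//.
    by rewrite -natrX ler_nat.
  have Lx : L%:R * ln 2 <= x.
    rewrite mulr_natl -lnXn// ler_ln ?posrE ?exprn_gt0//.
    by rewrite -natrX ler_nat.
  have L2x : L%:R <= 2 * x by clear -Lx ln2l LR1; nra.
  have lnLy : ln L%:R <= ln 2 + y.
    by rewrite -lnM ?posrE// ler_ln ?posrE ?mulr_gt0// ltr0n.
  have l1 : 0 <= (l.-1)%:R :> R by [].
  have lE : l%:R = (l.-1)%:R + 1 :> R by rewrite natr1.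
  by rewrite lE; clear -lnL lnLy ln2l ln2u y1 l1; nra.
have X_le : X <= M * y.
  rewrite /X ler_pdivrMr//.
  have x2L : x <= 2 * L%:R by clear -xL LR1; lra.
  have L48 : L%:R <= 48 * l%:R * r%:R :> R by rewrite -!natrM ler_nat ltnW.
  apply: (@le_trans _ _ (16 * (a * (2 * (48 * (5 * y) * r%:R))))).
    2: by rewrite ME; lra.
  rewrite ler_pM2l//; apply: le_trans alpha_le _; rewrite ler_pM2l//.
  apply: le_trans x2L _; rewrite ler_pM2l//; apply: le_trans L48 _.
  by rewrite ler_pM2r// ler_pM2l.
have X0 : 0 < X by rewrite divr_gt0// mulr_gt0// (lt_le_trans _ alpha1).
have lnX : ln X <= C * w.
  apply: (@le_trans _ _ (ln (M * y))).
    by rewrite ler_ln ?posrE// mulr_gt0.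
  rewrite lnM ?posrE// -/w /C mulrDl mul1r [leRHS]addrC lerD2r.
  by rewrite mulrAC ler_pdivlMr// ler_pM2l.
have kC : x <= 32 * C * (k%:R * w).
  have h1 : k%:R * ln X <= k%:R * (C * w) by rewrite ler_pM2l// ltr0n.
  have h2 : k%:R * (C * w) = C * (k%:R * w) by ring.
  by move: h1 scale_le lr_low xL LR1; rewrite h2; clear; lra.
apply: (@le_trans _ _ (1 / (32 * C) * x)).
  by rewrite ler_pM2r// ge_min lexx orbT.
by rewrite mul1r mulrC ler_pdivrMr ?mulr_gt0// mulrC.
Qed.
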